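(* Let $k\ge 2$ be the order of the scheme and $\widehat\omega_1=\frac{1}{L(L-1)}$ with $L=\lceil \frac{k+2}{2}\rceil$. Assume $\overline{\mathbf U}_{ij}\in G$ for all $i,j$. Assume the interface values $\mathbf U_{i+\frac12,j}^{\pm,\mu}$, $\mathbf U_{i,j+\frac12}^{\mu,\pm}$ satisfy, for all $i,j$, the following. (i) Discrete divergence-free condition: $$\nabla_h\cdot\mathbf B_{ij}:=\sum_{\mu=1}^Q\omega_\mu\left(\frac{(B_1)_{i+\frac12,j}^{-,\mu}-(B_1)_{i-\frac12,j}^{+,\mu}}{\Delta x}+\frac{(B_2)_{i,j+\frac12}^{\mu,-}-(B_2)_{i,j-\frac12}^{\mu,+}}{\Delta y}\right)=0 .$$ (ii) $\mathbf U_{i+\frac12,j}^{\pm,\mu}\in G$ and $\mathbf U_{i,j+\frac12}^{\mu,\pm}\in G$ for all $\mu$, and, if $k\ge 3$, $$\mathbf\Pi_{ij}:=\frac{\overline{\mathbf U}_{ij}-\frac{\widehat\omega_1}{\lambda}\left[\lambda_1\left(\mathbf\Pi_{i-\frac12,j}^{+}+\mathbf\Pi_{i+\frac12,j}^{-}\right)+\lambda_2\left(\mathbf\Pi_{i,j-\frac12}^{+}+\mathbf\Pi_{i,j+\frac12}^{-}\right)\right]}{1-2\widehat\omega_1}\in G .$$ Suppose the viscosity parameters satisfy $\alpha_1^{\rm LF}\ge\hat\alpha_1^{\rm LF}+\beta_1$ and $\alpha_2^{\rm LF}\ge\hat\alpha_2^{\rm LF}+\beta_2$, where $$\hat\alpha_1^{\rm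 LF}=\max_{i,j,\mu}\max\left\{\alpha_1(\mathbf U_{i+\frac12,j}^{-,\mu},\mathbf U_{i-\frac12,j}^{+,\mu}),\ \alpha_1(\mathbf U_{i+\frac12,j}^{+,\mu},\mathbf U_{i-\frac12,j}^{-,\mu})\right\},$$ $$\hat\alpha_2^{\rm LF}=\max_{i,j,\mu}\max\left\{\alpha_2(\mathbf U_{i,j+\frac12}^{\mu,-},\mathbf U_{i,j-\frac12}^{\mu,+}),\ \alpha_2(\mathbf U_{i,j+\frac12}^{\mu,+},\mathbf U_{i,j-\frac12}^{\mu,-})\right\},$$ $$\beta_1=\max_{i,j,\mu}\frac{\left|[\![B_1]\!]_{i+\frac12,j}^{\mu}\right|}{2\sqrt{\{\!\{\rho\}\!\}_{i+\frac12,j}^{\mu}}},\qquad \beta_2=\max_{i,j,\mu}\frac{\left|[\![B_2]\!]_{i,j+\frac12}^{\mu}\right|}{2\sqrt{\{\!\{\rho\}\!\}_{i,j+\frac12}^{\mu}}} .$$ Then, under the CFL condition $$0<\Delta t\left(\frac{\alpha_1^{\rm LF}}{\Delta x}+\frac{\alpha_2^{\rm LF}}{\Delta y}\right)<\widehat\omega_1,$$ the scheme is positivity-preserving, i.e. the updated cell averages satisfy $$\overline{\mathbf U}_{ij}^{\Delta t}:=\overline{\mathbf U}_{ij}+\Delta t\,\mathcal L_{ij}(\overline{\mathbf U})\in G\qquad\text{for all } i,j .$$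
   Context: **States.** $\mathbf U=(\rho,\mathbf m,\mathbf B,E)^\top\in\mathbb R^8$ with $\mathbf m,\mathbf B\in\mathbb R^3$; $\mathbf v=\mathbf m/\rho$. The internal energy function is $\mathcal E(\mathbf U)=E-\frac12\left(\frac{|\mathbf m|^2}{\rho}+|\mathbf B|^2\right)=\rho e$ ($e$ is the specific internal energy). The admissible set is $G=\{\mathbf U:\rho>0,\ \mathcal E(\mathbf U)>0\}$. The thermal pressure $p$ is determined by $\rho$ and $e$ through an equation of state $e=e(\rho,p)$ which satisfies $e>0\Leftrightarrow p>0$ whenever $\rho>0$. **Fluxes and source vector.** For $i=1,2,3$, with $p_{tot}=p+\frac12|\mathbf B|^2$ and $\mathbf e_i$ the $i$th row of the $3\times3$ identity matrix, $$\mathbf F_i(\mathbf U)=\left(m_i,\ m_i\mathbf v-B_i\mathbf B+p_{tot}\mathbf e_i,\ v_i\mathbf B-B_i\mathbf v,\ v_i(E+p_{tot})-B_i(\mathbf v\cdot\mathbf B)\right)^\top,$$ and $\mathbf S(\mathbf U)=(0,\mathbf B,\mathbf v,\mathbf v\cdot\mathbf B)^\top$. **Wave speed bounds.** For $\mathbf U,\widetilde{\mathbf U}\in G$ (tildes on quantities refer to $\widetilde{\mathbf U}$), $$\alpha_i(\mathbf U,\widetilde{\mathbf U})=\max\left\{|v_i|+\mathcal C_i,\ |\widetilde v_i|+\widetilde{\mathcal C}_i,\ \frac{\left|\sqrt\rho\,v_i+\sqrt{\widetilde\rho}\,\widetilde v_i\right|}{\sqrt\rho+\sqrt{\widetilde\rho}}+\max\{\mathcal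 C_i,\widetilde{\mathcal C}_i\}\right\}+\frac{|\mathbf B-\widetilde{\mathbf B}|}{\sqrt\rho+\sqrt{\widetilde\rho}},$$ $$\mathcal C_i=\frac1{\sqrt2}\left[\mathcal C_s^2+\frac{|\mathbf B|^2}{\rho}+\sqrt{\left(\mathcal C_s^2+\frac{|\mathbf B|^2}{\rho}\right)^2-\frac{4\mathcal C_s^2B_i^2}{\rho}}\right]^{1/2},\qquad \mathcal C_s=\frac{p}{\rho\sqrt{2e}} .$$ **Mesh and quadrature.** The 2D domain is partitioned into uniform rectangular cells $I_{ij}=(x_{i-\frac12},x_{i+\frac12})\times(y_{j-\frac12},y_{j+\frac12})$ with step sizes $\Delta x,\Delta y>0$. Indices $i,j$ range over the cells, and every cell edge is treated as an interior interface carrying limiting values from both sides. A $Q$-point quadrature of sufficient accuracy for order $k$ is used on each cell edge (e.g. Gauss with $Q=\lceil k/2\rceil$ or Gauss--Lobatto with $Q=\lceil (k+2)/2\rceil$), with positive weights $\omega_1,\dots,\omega_Q$ normalized so that $\sum_\mu\omega_\mu=1$ and nodes $x_i^\mu$, $y_j^\mu$. The vectors $\mathbf U_{i+\frac12,j}^{\pm,\mu}$ and $\mathbf U_{i,j+\frac12}^{\mu,\pm}$ in $\mathbb R^8$ denote reconstructed limiting values at $(x_{i+\frac12}^\pm,y_j^\mu)$ and $(x_i^\mu,y_{j+\frac12}^\pm)$ ($-$: from the left/lower cell, $+$: from the right/upper cell); $(B_\ell)$ with the same indices denote their magnetic components. $\overline{\mathbf U}_{ij}$ denotes the cell average on $I_{ij}$.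 **Weighted edge values.** $\mathbf\Pi_{i+\frac12,j}^{\pm}=\sum_\mu\omega_\mu\mathbf U_{i+\frac12,j}^{\pm,\mu}$, $\mathbf\Pi_{i,j+\frac12}^{\pm}=\sum_\mu\omega_\mu\mathbf U_{i,j+\frac12}^{\mu,\pm}$; $\lambda_1=\alpha_1^{\rm LF}\Delta t/\Delta x$, $\lambda_2=\alpha_2^{\rm LF}\Delta t/\Delta y$, $\lambda=\lambda_1+\lambda_2$. **Second-order case.** When $k=2$ (so $\widehat\omega_1=\frac12$), the interface values are the edge-midpoint values ($Q=1$) of a function that is linear in each cell with cell average $\overline{\mathbf U}_{ij}$, so that $\mathbf\Pi_{i+\frac12,j}^-+\mathbf\Pi_{i-\frac12,j}^+=2\overline{\mathbf U}_{ij}=\mathbf\Pi_{i,j+\frac12}^-+\mathbf\Pi_{i,j-\frac12}^+$. **Jumps and averages.** For a quantity $w$ with interface values, $[\![w]\!]_{i+\frac12,j}^\mu=w_{i+\frac12,j}^{+,\mu}-w_{i+\frac12,j}^{-,\mu}$, $\{\!\{w\}\!\}_{i+\frac12,j}^\mu=\frac12(w_{i+\frac12,j}^{+,\mu}+w_{i+\frac12,j}^{-,\mu})$; and $[\![w]\!]_{i,j+\frac12}^\mu=w_{i,j+\frac12}^{\mu,+}-w_{i,j+\frac12}^{\mu,-}$, $\{\!\{w\}\!\}_{i,j+\frac12}^\mu=\frac12(w_{i,j+\frac12}^{\mu,+}+w_{i,j+\frac12}^{\mu,-})$. **Scheme.** With the Lax--Friedrichs flux $\widehat{\mathbf F}_\ell(\mathbf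 U^-,\mathbf U^+)=\frac12\left(\mathbf F_\ell(\mathbf U^-)+\mathbf F_\ell(\mathbf U^+)-\alpha_\ell^{\rm LF}(\mathbf U^+-\mathbf U^-)\right)$, $\ell=1,2$, set $$\widehat{\mathbf F}_{1,i+\frac12,j}=\sum_\mu\omega_\mu\widehat{\mathbf F}_1(\mathbf U_{i+\frac12,j}^{-,\mu},\mathbf U_{i+\frac12,j}^{+,\mu}),\qquad \widehat{\mathbf F}_{2,i,j+\frac12}=\sum_\mu\omega_\mu\widehat{\mathbf F}_2(\mathbf U_{i,j+\frac12}^{\mu,-},\mathbf U_{i,j+\frac12}^{\mu,+}),$$ $$\mathbf S_{ij}=-\frac1{\Delta x}\sum_\mu\omega_\mu\left(\tfrac12[\![B_1]\!]_{i+\frac12,j}^\mu\mathbf S(\{\!\{\mathbf U\}\!\}_{i+\frac12,j}^\mu)+\tfrac12[\![B_1]\!]_{i-\frac12,j}^\mu\mathbf S(\{\!\{\mathbf U\}\!\}_{i-\frac12,j}^\mu)\right)$$ $$\qquad-\frac1{\Delta y}\sum_\mu\omega_\mu\left(\tfrac12[\![B_2]\!]_{i,j+\frac12}^\mu\mathbf S(\{\!\{\mathbf U\}\!\}_{i,j+\frac12}^\mu)+\tfrac12[\![B_2]\!]_{i,j-\frac12}^\mu\mathbf S(\{\!\{\mathbf U\}\!\}_{i,j-\frac12}^\mu)\right),$$ $$\mathcal L_{ij}(\overline{\mathbf U})=-\frac1{\Delta x}\left(\widehat{\mathbf F}_{1,i+\frac12,j}-\widehat{\mathbf F}_{1,i-\frac12,j}\right)-\frac1{\Delta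 y}\left(\widehat{\mathbf F}_{2,i,j+\frac12}-\widehat{\mathbf F}_{2,i,j-\frac12}\right)+\mathbf S_{ij}.$$ *)

(* Defs.v *)
From mathcomp Require Import all_boot all_order all_algebra.

Set Implicit Arguments.
Unset Strict Implicit.
Unset Printing Implicit Defensive.

Import Order.TTheory GRing.Theory Num.Theory.
Local Open Scope ring_scope.

Section EuclideanSpace.
Variable R : rcfType.

Definition dot n (u v : 'rV[R]_n) : R := \sum_i u 0 i * v 0 i.

Definition enorm n (u : 'rV[R]_n) : R := Num.sqrt (dot u u).

End EuclideanSpace.

Section MHD.
Variable R : rcfType.

(* A point of R^8, written as a row and split in blocks (rho, m, B, E). *)
Definition state := 'rV[R]_(1 + 3 + 3 + 1).

Definition mk_state (rho : R) (m B : 'rV[R]_3) (E : R) : state :=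
  row_mx (row_mx (row_mx rho%:M m) B) E%:M.

Definition rho (U : state) : R := lsubmx (lsubmx (lsubmx U)) 0 0.
Definition mom (U : state) : 'rV[R]_3 := rsubmx (lsubmx (lsubmx U)).
Definition mag (U : state) : 'rV[R]_3 := rsubmx (lsubmx U).
Definition Etot (U : state) : R := rsubmx U 0 0.

Definition vel (U : state) : 'rV[R]_3 := (rho U)^-1 *: mom U.

Definition rho_e (U : state) : R :=
  Etot U - 2^-1 * (enorm (mom U) ^+ 2 / rho U + enorm (mag U) ^+ 2).

Definition spec_e (U : state) : R := rho_e U / rho U.

Definition admissible (U : state) : Prop := 0 < rho U /\ 0 < rho_e U.

(* [eos rho p] is the specific internal energy. *)
Definition eos_positive (eos : R -> R -> R) : Prop :=
  forall r p, 0 < r -> (0 < eos r p <-> 0 < p).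

(* [pres r e] is the unique pressure solving [eos r p = e]; it is only
   constrained where density and internal energy are positive. *)
Definition eos_pressure (eos pres : R -> R -> R) : Prop :=
  forall r e, 0 < r -> 0 < e -> forall p, eos r p = e <-> p = pres r e.

Variable pres : R -> R -> R.

Definition pressure (U : state) : R := pres (rho U) (spec_e U).

Definition ptot (U : state) : R := pressure U + 2^-1 * enorm (mag U) ^+ 2.

Definition flux (i : 'I_3) (U : state) : state :=
  mk_state
    (mom U 0 i)
    (mom U 0 i *: vel U - mag U 0 i *: mag U + ptot U *: row i 1%:M)
    (vel U 0 i *: mag U - mag U 0 i *: vel U)
    (vel U 0 i * (Etot U + ptot U) - mag U 0 i * dot (vel U) (mag U)).

Definition source (U : state) : state :=
  mk_state 0 (mag U) (vel U) (dot (vel U) (mag U)).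

Definition Cs (U : state) : R :=
  pressure U / (rho U * Num.sqrt (2 * spec_e U)).

Definition Cfast (i : 'I_3) (U : state) : R :=
  let a := Cs U ^+ 2 + enorm (mag U) ^+ 2 / rho U in
  (Num.sqrt 2)^-1 *
  Num.sqrt (a + Num.sqrt (a ^+ 2 - 4 * Cs U ^+ 2 * mag U 0 i ^+ 2 / rho U)).

Definition alpha (i : 'I_3) (U V : state) : R :=
  let s := Num.sqrt (rho U) + Num.sqrt (rho V) in
  Num.max (`|vel U 0 i| + Cfast i U)
    (Num.max (`|vel V 0 i| + Cfast i V)
       (`|Num.sqrt (rho U) * vel U 0 i + Num.sqrt (rho V) * vel V 0 i| / s
        + Num.max (Cfast i U) (Cfast i V)))
  + enorm (mag U - mag V) / s.

Definition LFflux (i : 'I_3) (a : R) (Um Up : state) : state :=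
  2^-1 *: (flux i Um + flux i Up - a *: (Up - Um)).

Definition jump (i : 'I_3) (Um Up : state) : R := mag Up 0 i - mag Um 0 i.

Definition avg (Um Up : state) : state := 2^-1 *: (Up + Um).

End MHD.

(* An Nx x Ny mesh has cells indexed by 'I_Nx * 'I_Ny, while its vertical
   (resp. horizontal) edges are indexed by 'I_Nx.+1 * 'I_Ny
   (resp. 'I_Nx * 'I_Ny.+1); [lo i] and [hi i] are the edges i-1/2 and i+1/2. *)
Definition lo n (i : 'I_n) : 'I_n.+1 := widen_ord (leqnSn n) i.
Definition hi n (i : 'I_n) : 'I_n.+1 := lift ord0 i.

(* UxM, UxP (resp. UyM, UyP) are the -/+ limiting values at the quadrature
   nodes of the vertical (resp. horizontal) edges. *)
Record mesh_data (R : rcfType) (Nx Ny Q : nat) := MeshData {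
  dx : R;
  dy : R;
  omega : 'I_Q -> R;
  Ubar : 'I_Nx -> 'I_Ny -> state R;
  UxM : 'I_Nx.+1 -> 'I_Ny -> 'I_Q -> state R;
  UxP : 'I_Nx.+1 -> 'I_Ny -> 'I_Q -> state R;
  UyM : 'I_Nx -> 'I_Ny.+1 -> 'I_Q -> state R;
  UyP : 'I_Nx -> 'I_Ny.+1 -> 'I_Q -> state R
}.

Section Scheme.
Variables (R : rcfType) (Nx Ny Q : nat) (D : mesh_data R Nx Ny Q).

Local Notation c1 := (0 : 'I_3).
Local Notation c2 := (1 : 'I_3).

Definition mesh_positive : Prop := 0 < dx D /\ 0 < dy D.

Definition weights_normalized : Prop :=
  (forall mu, 0 < omega D mu) /\ \sum_mu omega D mu = 1.

Definition cells_admissible : Prop := forall i j, admissible (Ubar D i j).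

Definition edges_admissible : Prop :=
  (forall i j mu, admissible (UxM D i j mu) /\ admissible (UxP D i j mu)) /\
  (forall i j mu, admissible (UyM D i j mu) /\ admissible (UyP D i j mu)).

Definition divB (i : 'I_Nx) (j : 'I_Ny) : R :=
  \sum_mu omega D mu *
    ((mag (UxM D (hi i) j mu) 0 c1 - mag (UxP D (lo i) j mu) 0 c1) / dx D
     + (mag (UyM D i (hi j) mu) 0 c2 - mag (UyP D i (lo j) mu) 0 c2) / dy D).

Definition PixM i j : state R := \sum_mu omega D mu *: UxM D i j mu.
Definition PixP i j : state R := \sum_mu omega D mu *: UxP D i j mu.
Definition PiyM i j : state R := \sum_mu omega D mu *: UyM D i j mu.
Definition PiyP i j : state R := \sum_mu omega D mu *: UyP D i j mu.

(* uphalf n is the ceiling of n / 2 *)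
Definition omega_hat (k : nat) : R :=
  let L := uphalf (k + 2) in (L%:R * (L%:R - 1))^-1.

Definition Pi_cell (k : nat) (dt a1 a2 : R) (i : 'I_Nx) (j : 'I_Ny) : state R :=
  let lam1 := a1 * dt / dx D in
  let lam2 := a2 * dt / dy D in
  let lam := lam1 + lam2 in
  (1 - 2 * omega_hat k)^-1 *:
    (Ubar D i j - (omega_hat k / lam) *:
       (lam1 *: (PixP (lo i) j + PixM (hi i) j)
        + lam2 *: (PiyP i (lo j) + PiyM i (hi j)))).

(* In each cell the function is Ubar + xi *: a + eta *: b, where (xi, eta) is
   the offset from the cell centre: these are the affine functions with cell
   average Ubar. *)
Definition piecewise_linear_midpoint : Prop :=
  forall (i : 'I_Nx) (j : 'I_Ny), exists a b : state R,
    let u (xi eta : R) := Ubar D i j + xi *: a + eta *: b in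
    forall mu : 'I_Q,
      [/\ UxM D (hi i) j mu = u (dx D / 2) 0,
          UxP D (lo i) j mu = u (- (dx D / 2)) 0,
          UyM D i (hi j) mu = u 0 (dy D / 2) &
          UyP D i (lo j) mu = u 0 (- (dy D / 2))].

Section Viscosity.
Variable pres : R -> R -> R.

(* The maximands below are nonnegative, so 0 is a neutral starting value. *)
Definition alpha_hat1 : R :=
  \big[Num.max/0]_(i < Nx) \big[Num.max/0]_(j < Ny) \big[Num.max/0]_(mu < Q)
    Num.max (alpha pres c1 (UxM D (hi i) j mu) (UxP D (lo i) j mu))
            (alpha pres c1 (UxP D (hi i) j mu) (UxM D (lo i) j mu)).

Definition alpha_hat2 : R :=
  \big[Num.max/0]_(i < Nx) \big[Num.max/0]_(j < Ny) \big[Num.max/0]_(mu < Q)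
    Num.max (alpha pres c2 (UyM D i (hi j) mu) (UyP D i (lo j) mu))
            (alpha pres c2 (UyP D i (hi j) mu) (UyM D i (lo j) mu)).

(* Here i (resp. j) runs over all the edges, including the outermost ones. *)
Definition beta1 : R :=
  \big[Num.max/0]_(i < Nx.+1) \big[Num.max/0]_(j < Ny) \big[Num.max/0]_(mu < Q)
    (`|jump c1 (UxM D i j mu) (UxP D i j mu)|
     / (2 * Num.sqrt (rho (avg (UxM D i j mu) (UxP D i j mu))))).

Definition beta2 : R :=
  \big[Num.max/0]_(i < Nx) \big[Num.max/0]_(j < Ny.+1) \big[Num.max/0]_(mu < Q)
    (`|jump c2 (UyM D i j mu) (UyP D i j mu)|
     / (2 * Num.sqrt (rho (avg (UyM D i j mu) (UyP D i j mu))))).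

Definition Fhat1 (a1 : R) i j : state R :=
  \sum_mu omega D mu *: LFflux pres c1 a1 (UxM D i j mu) (UxP D i j mu).

Definition Fhat2 (a2 : R) i j : state R :=
  \sum_mu omega D mu *: LFflux pres c2 a2 (UyM D i j mu) (UyP D i j mu).

Definition jump_source (c : 'I_3) (Um Up : state R) : state R :=
  (2^-1 * jump c Um Up) *: source (avg Um Up).

Definition Sh (i : 'I_Nx) (j : 'I_Ny) : state R :=
  - (dx D)^-1 *: (\sum_mu omega D mu *:
       (jump_source c1 (UxM D (hi i) j mu) (UxP D (hi i) j mu)
        + jump_source c1 (UxM D (lo i) j mu) (UxP D (lo i) j mu)))
  - (dy D)^-1 *: (\sum_mu omega D mu *:
       (jump_source c2 (UyM D i (hi j) mu) (UyP D i (hi j) mu)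
        + jump_source c2 (UyM D i (lo j) mu) (UyP D i (lo j) mu))).

Definition Lh (a1 a2 : R) (i : 'I_Nx) (j : 'I_Ny) : state R :=
  - (dx D)^-1 *: (Fhat1 a1 (hi i) j - Fhat1 a1 (lo i) j)
  - (dy D)^-1 *: (Fhat2 a2 i (hi j) - Fhat2 a2 i (lo j))
  + Sh i j.

End Viscosity.
End Scheme.

(* Main.v *)
Require Import Defs.
From mathcomp Require Import all_boot all_order all_algebra.
From HB Require Import structures.
From mathcomp Require Import ring lra.

Import Order.TTheory GRing.Theory Num.Theory.
Local Open Scope ring_scope.

(** Admissibility is not a linear condition on the conserved variables, but it
    is equivalent to positivity of the density together with positivity, for
    every auxiliary velocity v and magnetic field b, of the affine function
      phi U = (|v|^2 / 2) rho - v . m - b . B + E + |b|^2 / 2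
            = rho e + rho |w|^2 / 2 + |d|^2 / 2,   w = u - v,  d = B - b,
    where u is the fluid velocity ([admissibleP]): minimising over v and b
    recovers the internal energy.  Since each phi is affine, it can be
    evaluated on the scheme term by term, and the whole proof is an estimate of
    one affine function with coefficients v and b fixed.

    Let l be the linear part of phi.  A flux cannot be bounded alone by the
    viscosity times phi, because l (F_i U) has terms growing with v and b faster
    than phi.  These terms cancel in the difference of two states, up to
    (B_i - B_i') (v . b): this is [flux_energy_pair].  What remains splits into
    a part controlled by the fast magnetosonic speed ([Cfast_bound], an
    eigenvalue estimate) and v_i (|d|^2 - |d'|^2) / 2.  In the latter, v_i is
    rewritten as the sqrt(rho)-weighted mean of the fluid velocities minus that
    of the relative velocities; the factor |d|^2 - |d'|^2 contains B - B',
    which yields the additional term |B - B'| / (sqrt rho + sqrt rho') of the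
    wave speed bound.

    In a cell, the four traces of each direction are paired across the cell:
    the two inner traces with each other and the two outer ones with each
    other.  The residues (B_i - B_i') (v . b) of the two pairs add up to twice
    the inner difference plus the two interface jumps.  The jumps are
    cancelled by the Godunov--Powell source term, at the price of a quadratic
    term absorbed by the viscosity margin beta ([interface_balance]); the inner
    differences sum to the discrete divergence, which vanishes
    ([scheme_functional_ge]).  So the update loses at most
    dt a1 / dx and dt a2 / dy times phi at the weighted inner traces, and under
    the CFL condition this is a strict fraction of what the decomposition of the
    cell average into Pi and inner traces provides ([update_functional_gt0]).

    The density satisfies the same three estimates with v . b replaced by 0, so
    both functionals are treated at once through [positivity_functional]. *)

(** * Euclidean products and the fast wave speed as an eigenvalue bound *)

Section Dot.
Context {R : rcfType} {n : nat}.

Lemma dotC (u v : 'rV[R]_n) : dot u v = dot v u.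
Proof. by apply: eq_bigr => i _; rewrite mulrC. Qed.

Lemma dotDl (u v w : 'rV[R]_n) : dot (u + v) w = dot u w + dot v w.
Proof. by rewrite -big_split; apply: eq_bigr => i _; rewrite mxE mulrDl. Qed.

Lemma dotZl a (u v : 'rV[R]_n) : dot (a *: u) v = a * dot u v.
Proof. by rewrite /dot mulr_sumr; apply: eq_bigr => i _; rewrite mxE mulrA. Qed.

Lemma dotNl (u v : 'rV[R]_n) : dot (- u) v = - dot u v.
Proof. by rewrite -scaleN1r dotZl mulN1r. Qed.

Lemma dotDr (u v w : 'rV[R]_n) : dot w (u + v) = dot w u + dot w v.
Proof. by rewrite dotC dotDl ![dot _ w]dotC. Qed.

Lemma dotZr a (u v : 'rV[R]_n) : dot v (a *: u) = a * dot v u.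
Proof. by rewrite dotC dotZl dotC. Qed.

Lemma dotNr (u v : 'rV[R]_n) : dot v (- u) = - dot v u.
Proof. by rewrite dotC dotNl dotC. Qed.

Definition dotE := (dotDl, dotDr, dotNl, dotNr, dotZl, dotZr).

Lemma dot_row1 (u : 'rV[R]_n) i : dot u (row i 1%:M) = u 0 i.
Proof.
rewrite /dot (bigD1 i) //= big1 => [|j ji]; rewrite !mxE ?eqxx ?mulr1 ?addr0 //.
by rewrite eq_sym (negPf ji) mulr0.
Qed.

Lemma sqr_entry_le_dot (u : 'rV[R]_n) i : u 0 i ^+ 2 <= dot u u.
Proof.
rewrite /dot (bigD1 i) //= expr2 lerDl.
by apply: sumr_ge0 => j _; rewrite -expr2 sqr_ge0.
Qed.

Lemma dot_ge0 (u : 'rV[R]_n) : 0 <= dot u u.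
Proof. by apply: sumr_ge0 => i _; rewrite -expr2 sqr_ge0. Qed.

Lemma dot_eq0 (u : 'rV[R]_n) : dot u u = 0 -> u = 0.
Proof.
move=> u0; apply/rowP => i; rewrite mxE; apply/eqP; rewrite -sqrf_eq0.
by rewrite eq_le sqr_ge0 andbT -u0 sqr_entry_le_dot.
Qed.

Lemma sqr_enorm (u : 'rV[R]_n) : enorm u ^+ 2 = dot u u.
Proof. by rewrite sqr_sqrtr ?dot_ge0. Qed.

Lemma enorm_ge0 (u : 'rV[R]_n) : 0 <= enorm u.
Proof. exact: sqrtr_ge0. Qed.

(** Young's inequality with the weight |d|: for nonzero d it is the
    nonnegativity of | |d| c - g d |^2. *)
Lemma young_dot (d c : 'rV[R]_n) (g : R) :
  g * dot d c <= enorm d * (g ^+ 2 + dot c c) / 2.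
Proof.
have [d_gt0|d0] := ltP 0 (enorm d); last first.
  have d0' : enorm d = 0 by apply/le_anti; rewrite d0 enorm_ge0.
  have -> : d = 0 by apply: dot_eq0; rewrite -sqr_enorm d0' expr0n.
  rewrite -(scale0r (0 : 'rV_n)) dotZl mul0r mulr0 -mulrA.
  apply: mulr_ge0; rewrite ?enorm_ge0 //.
  by rewrite divr_ge0 ?addr_ge0 ?sqr_ge0 ?dot_ge0.
rewrite -(ler_pM2l d_gt0).
have := dot_ge0 (enorm d *: c - g *: d).
rewrite !dotE (dotC c d) -(sqr_enorm d); lra.
Qed.

(** Lets an estimate with constant c be proved with any larger constant, so
    that degenerate values of c need no separate treatment. *)
Lemma ler_mul_gt (l c m : R) : 0 <= m ->
  (forall s, c < s -> l <= s * m) -> l <= c * m.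
Proof.
move=> m_ge0 H; apply/ler_addgt0Pr => e e_gt0.
have m1 : 0 < m + 1 by lra.
have em : 0 < e / (m + 1) by rewrite divr_gt0.
apply: le_trans (H (c + e / (m + 1)) _) _; first by lra.
have : e / (m + 1) * (m + 1) = e by rewrite divfK ?gt_eqF.
nra.
Qed.

(** The left-hand side is the bilinear pairing of x with (y, b) given by the
    normal part of the linearised MHD flux.  It equals (q x_i) y + z . b, with
    z = x_i be - be_i x, so by Young it suffices that the squared norm of
    (q x_i, z) be at most s^2 |x|^2.  After multiplication by
    r = s^2 - be_i^2 > 0 and use of the last hypothesis, this follows since
    the i-th entry of r x + x_i be_i be, namely s^2 x_i, has square at
    most the squared norm of that vector. *)
Lemma fast_speed_bound_gt (i : 'I_n) (x b be : 'rV[R]_n) (q y s : R) :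
  0 < s -> be 0 i ^+ 2 < s ^+ 2 ->
  (q ^+ 2 + dot be be) * s ^+ 2 <= s ^+ 4 + q ^+ 2 * be 0 i ^+ 2 ->
  q * x 0 i * y + x 0 i * dot be b - be 0 i * dot x b <=
  s * ((dot x x + dot b b + y ^+ 2) / 2).
Proof.
set bi := be 0 i; set xi := x 0 i => s_gt0 bs as_.
pose z := xi *: be - bi *: x.
have zE : dot z z =
    xi ^+ 2 * dot be be - 2 * xi * bi * dot be x + bi ^+ 2 * dot x x.
  by rewrite /z !dotE (dotC x be); ring.
have bound : q ^+ 2 * xi ^+ 2 + dot z z <= s ^+ 2 * dot x x.
  rewrite zE; set r := s ^+ 2 - bi ^+ 2.
  have r_gt0 : 0 < r by rewrite subr_gt0.
  rewrite -(ler_pM2l r_gt0).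
  have := sqr_entry_le_dot (r *: x + (xi * bi) *: be) i.
  rewrite !dotE !mxE -/xi -/bi (dotC x be).
  have -> : r * xi + xi * bi * bi = s ^+ 2 * xi by rewrite /r; ring.
  have := ler_wpM2l (sqr_ge0 xi) as_.
  rewrite /r; lra.
have -> : q * xi * y + xi * dot be b - bi * dot x b = q * xi * y + dot z b.
  by rewrite !dotE; ring.
rewrite -(ler_pM2l s_gt0).
clearbody z; have := dot_ge0 (s *: b - z); have := sqr_ge0 (s * y - q * xi).
rewrite !dotE (dotC b z); lra.
Qed.

(** The constant is the square root C of the larger root of
    T^2 - (q^2 + |be|^2) T + q^2 be_i^2, which is at least be_i^2, so every
    s > C satisfies the hypotheses of [fast_speed_bound_gt].  Passing to the
    limit covers the cases C^2 = be_i^2 and C = 0. *)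
Lemma fast_speed_bound (i : 'I_n) (x b be : 'rV[R]_n) (q y : R) :
  let a := q ^+ 2 + dot be be in
  q * x 0 i * y + x 0 i * dot be b - be 0 i * dot x b <=
  (Num.sqrt 2)^-1 * Num.sqrt (a + Num.sqrt (a ^+ 2 - 4 * q ^+ 2 * be 0 i ^+ 2))
  * ((dot x x + dot b b + y ^+ 2) / 2).
Proof.
lazy zeta; set a := q ^+ 2 + dot be be.
set r := Num.sqrt (a ^+ 2 - _).
set t := a + r; set C := _^-1 * _.
have bi2 : be 0 i ^+ 2 <= dot be be := sqr_entry_le_dot _ _.
have q2 := sqr_ge0 q; have bi2_ge0 := sqr_ge0 (be 0 i).
have a_ge0 : 0 <= a by rewrite /a; lra.
have disc_ge : (q ^+ 2 - be 0 i ^+ 2) ^+ 2 <=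
               a ^+ 2 - 4 * q ^+ 2 * be 0 i ^+ 2.
  rewrite /a; nra.
have disc_ge0 := le_trans (sqr_ge0 _) disc_ge.
have r_ge0 : 0 <= r := sqrtr_ge0 _.
have r2 : r ^+ 2 = a ^+ 2 - 4 * q ^+ 2 * be 0 i ^+ 2 by rewrite sqr_sqrtr.
have t_ge0 : 0 <= t by rewrite addr_ge0.
have C_ge0 : 0 <= C by rewrite mulr_ge0 ?invr_ge0 ?sqrtr_ge0.
have C2 : C ^+ 2 = t / 2 by rewrite exprMn exprVn !sqr_sqrtr ?ler0n // mulrC.
have C2_ge : be 0 i ^+ 2 <= C ^+ 2.
  have : be 0 i ^+ 2 - q ^+ 2 <= r.
    apply: le_trans (ler_norm _) _; rewrite -sqrtr_sqr ler_wsqrtr //.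
    by rewrite -sqrrN opprB.
  rewrite C2 /t /a; lra.
apply: ler_mul_gt => [|s Cs].
  by rewrite divr_ge0 ?addr_ge0 ?dot_ge0 ?sqr_ge0.
have Cs2 : C ^+ 2 < s ^+ 2.
  by rewrite ltr_pXn2r ?nnegrE // (le_trans C_ge0) ?ltW.
apply: fast_speed_bound_gt; first exact: le_lt_trans Cs.
  exact: le_lt_trans Cs2.
rewrite -/a; have : a / 2 <= C ^+ 2 by rewrite C2 /t; lra.
have : C ^+ 4 + q ^+ 2 * be 0 i ^+ 2 = a * C ^+ 2.
  have -> : C ^+ 4 = (C ^+ 2) ^+ 2 by rewrite -exprM.
  rewrite C2 /t; lra.
nra.
Qed.
End Dot.

(** * Conserved variables and the energy functionals *)

Section States.
Context {R : rcfType}.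
Implicit Types (U V : state R) (v b m B : 'rV[R]_3).

Lemma rho_mk r m B (E : R) : rho (mk_state r m B E) = r.
Proof. by rewrite /rho /mk_state !row_mxKl mxE. Qed.

Lemma mom_mk r m B (E : R) : mom (mk_state r m B E) = m.
Proof. by rewrite /mom /mk_state !row_mxKl row_mxKr. Qed.

Lemma mag_mk r m B (E : R) : mag (mk_state r m B E) = B.
Proof. by rewrite /mag /mk_state row_mxKl row_mxKr. Qed.

Lemma Etot_mk r m B (E : R) : Etot (mk_state r m B E) = E.
Proof. by rewrite /Etot /mk_state row_mxKr mxE. Qed.

Definition mk_stateE := (rho_mk, mom_mk, mag_mk, Etot_mk).

Lemma rho_is_scalar : scalar (@rho R).
Proof. by move=> a U V; rewrite /rho !linearP !mxE. Qed.
HB.instance Definition _ :=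
  GRing.isLinear.Build R (state R) R *%R (@rho R) rho_is_scalar.

Lemma mom_is_linear : linear (@mom R).
Proof. by move=> a U V; rewrite /mom !linearP. Qed.
HB.instance Definition _ :=
  GRing.isLinear.Build R (state R) 'rV[R]_3 *:%R (@mom R) mom_is_linear.

Lemma mag_is_linear : linear (@mag R).
Proof. by move=> a U V; rewrite /mag !linearP. Qed.
HB.instance Definition _ :=
  GRing.isLinear.Build R (state R) 'rV[R]_3 *:%R (@mag R) mag_is_linear.

Lemma Etot_is_scalar : scalar (@Etot R).
Proof. by move=> a U V; rewrite /Etot !linearP !mxE. Qed.
HB.instance Definition _ :=
  GRing.isLinear.Build R (state R) R *%R (@Etot R) Etot_is_scalar.

(** The pairing of U with (|v|^2/2, -v, -b, 1), the inward normals of the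
    convex set of admissible states. *)
Definition energy_form v b U : R :=
  2^-1 * dot v v * rho U - dot v (mom U) - dot b (mag U) + Etot U.

Lemma energy_form_is_scalar v b : scalar (energy_form v b).
Proof.
by move=> a U V; rewrite /energy_form !linearP /= !dotE; ring.
Qed.
HB.instance Definition _ v b :=
  GRing.isLinear.Build R (state R) R *%R (energy_form v b)
    (energy_form_is_scalar v b).

Lemma momE U : rho U != 0 -> mom U = rho U *: vel U.
Proof. by move=> r0; rewrite scalerA divff ?scale1r. Qed.

Lemma EtotE U : rho U != 0 ->
  Etot U = rho_e U + 2^-1 * (rho U * dot (vel U) (vel U) + dot (mag U) (mag U)).
Proof.
move=> r0; rewrite /rho_e !sqr_enorm momE //; move: (vel U) => u.
by rewrite !dotE; field.
Qed.

(** In the frame moving with v and relative to the field b, the affine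
    function is the total energy: this shows at once that it is positive on
    admissible states and that v = vel U, b = mag U make it minimal. *)
Lemma energy_formE v b U : rho U != 0 ->
  energy_form v b U + 2^-1 * dot b b =
  rho_e U + 2^-1 * (rho U * dot (vel U - v) (vel U - v))
  + 2^-1 * dot (mag U - b) (mag U - b).
Proof.
move=> r0; rewrite /energy_form EtotE // momE //; move: (vel U) => u.
by rewrite !dotE (dotC u v) (dotC (mag U) b); field.
Qed.

Context {pres : R -> R -> R}.

(** The first and the bracketed term are bounded by a multiple of phi that
    does not involve v or b.  The other three are not, and are only estimated
    for the difference of two states: the last cancels, the one before it
    produces the divergence of B, and |b'|^2 turns into a jump of B. *)
Lemma flux_energy_form i v b U : rho U != 0 ->
  let w := vel U - v in let b' := mag U - b in
  energy_form v b (flux pres i U) =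
    vel U 0 i * (rho_e U + 2^-1 * (rho U * dot w w))
    + v 0 i * (2^-1 * dot b' b')
    + (w 0 i * pressure pres U + w 0 i * dot (mag U) b' - mag U 0 i * dot w b')
    + mag U 0 i * dot v b - v 0 i * (2^-1 * dot b b).
Proof.
move=> r0 w b'; rewrite /energy_form !mk_stateE /w /b' {w b'}.
rewrite EtotE // momE // /ptot sqr_enorm; move: (vel U) => u.
rewrite !dotE dot_row1 !mxE (dotC u v) (dotC (mag U) b) (dotC b u).
by field.
Qed.

Lemma source_energy_form v b U :
  energy_form v b (source U) + dot v b = dot (vel U - v) (mag U - b).
Proof.
rewrite /energy_form !mk_stateE; move: (vel U) => u.
by rewrite !dotE (dotC b u); ring.
Qed.

Lemma Cfast_ge0 i U : 0 <= Cfast pres i U.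
Proof. by rewrite mulr_ge0 ?invr_ge0 ?sqrtr_ge0. Qed.

(** Scaling the velocity by sqrt rho and the field by 1 / sqrt rho turns this
    into [fast_speed_bound], with y = sqrt (2 rho e), so that the pressure work
    w_i p becomes Cs (sqrt rho w_i) y. *)
Lemma Cfast_bound i U (w b : 'rV[R]_3) : admissible U ->
  `|w 0 i * pressure pres U + w 0 i * dot (mag U) b - mag U 0 i * dot w b| <=
  Cfast pres i U * (rho_e U + 2^-1 * (rho U * dot w w) + 2^-1 * dot b b).
Proof.
move=> [r_gt0 e_gt0].
(* Changing the sign of w changes that of the bilinear term only. *)
wlog X_ge0 : w / 0 <= w 0 i * pressure pres U + w 0 i * dot (mag U) b
                     - mag U 0 i * dot w b.
  move=> H; have [/H //|X_lt0] := leP 0 (w 0 i * pressure pres U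
    + w 0 i * dot (mag U) b - mag U 0 i * dot w b).
  have := H (- w); rewrite !dotE mxE opprK -normrN => H'.
  apply: le_trans (H' _); last by lra.
  by rewrite le_eqVlt; apply/orP; left; apply/eqP; congr (`|_|); ring.
rewrite ger0_norm //.
set r := rho U in r_gt0 *; set s := Num.sqrt r.
have s_gt0 : 0 < s by rewrite sqrtr_gt0.
have s2 : s ^+ 2 = r by rewrite sqr_sqrtr ?ltW.
have se_gt0 : 0 < spec_e U by rewrite divr_gt0.
set y := Num.sqrt (2 * spec_e U).
have y_gt0 : 0 < y by rewrite sqrtr_gt0 mulr_gt0.
have y2 : y ^+ 2 = 2 * spec_e U by rewrite sqr_sqrtr // mulr_ge0 // ltW.
have := fast_speed_bound i (s *: w) b (s^-1 *: mag U) (Cs pres U) (s * y).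
have scE t (u : 'rV[R]_3) : (t *: u) 0 i = t * u 0 i by rewrite mxE.
rewrite !dotE !scE.
have -> : s^-1 * (s^-1 * dot (mag U) (mag U)) = enorm (mag U) ^+ 2 / r.
  by rewrite sqr_enorm -s2; field; rewrite gt_eqF.
have -> : 4 * Cs pres U ^+ 2 * (s^-1 * mag U 0 i) ^+ 2 =
          4 * Cs pres U ^+ 2 * mag U 0 i ^+ 2 / r.
  by rewrite -s2; field; rewrite gt_eqF.
have -> : Cs pres U * (s * w 0 i) * (s * y) = w 0 i * pressure pres U.
  by rewrite /Cs -/y -/r -s2; field; rewrite !gt_eqF.
have -> : s * w 0 i * (s^-1 * dot (mag U) b) = w 0 i * dot (mag U) b.
  by field; rewrite gt_eqF.
have -> : s^-1 * mag U 0 i * (s * dot w b) = mag U 0 i * dot w b.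
  by field; rewrite gt_eqF.
move=> /le_trans; apply; rewrite -/(Cfast pres i U).
rewrite le_eqVlt; apply/orP; left; apply/eqP; congr (_ * _).
rewrite exprMn y2 s2 /spec_e -/r -s2; field; exact: lt0r_neq0.
Qed.

Lemma alpha_ge i U V (s := Num.sqrt (rho U) + Num.sqrt (rho V))
    (D := enorm (mag U - mag V) / s)
    (W := (Num.sqrt (rho U) * vel U 0 i + Num.sqrt (rho V) * vel V 0 i) / s) :
  [/\ `|vel U 0 i| + Cfast pres i U + D <= alpha pres i U V,
      `|vel V 0 i| + Cfast pres i V + D <= alpha pres i U V,
      `|W| + Cfast pres i U + D <= alpha pres i U V,
      `|W| + Cfast pres i V + D <= alpha pres i U V & 0 <= D].
Proof.
have s_ge0 : 0 <= s by rewrite addr_ge0 ?sqrtr_ge0.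
have WE : `|W| =
    `|Num.sqrt (rho U) * vel U 0 i + Num.sqrt (rho V) * vel V 0 i| / s.
  by rewrite normrM normfV (ger0_norm s_ge0).
rewrite /alpha WE; split; rewrite ?lerD2r ?le_max ?lexx ?orbT //.
- by apply/orP; right; apply/orP; right; rewrite lerD2l le_max lexx.
- by apply/orP; right; apply/orP; right; rewrite lerD2l le_max lexx orbT.
- by rewrite divr_ge0 ?enorm_ge0.
Qed.

(** Apart from v_i (|d|^2 - |d'|^2) / 2 and the divergence residue, the terms
    of [flux_energy_form] are bounded separately for the two states, by the
    fluid velocity and [Cfast_bound].  In the former, v_i = W - g / s, where W is
    the weighted mean of the fluid velocities and g / s that of the relative
    velocities: W enters the third entry of the maximum in alpha, and g / s is
    handled by [young_dot] against B - B'. *)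
Lemma flux_energy_pair i v b U V : admissible U -> admissible V ->
  energy_form v b (flux pres i U) - energy_form v b (flux pres i V) <=
  alpha pres i U V * ((energy_form v b U + 2^-1 * dot b b)
                      + (energy_form v b V + 2^-1 * dot b b))
  + (mag U 0 i - mag V 0 i) * dot v b.
Proof.
move=> aU aV; have [rU eU] := aU; have [rV eV] := aV.
have rU0 := lt0r_neq0 rU; have rV0 := lt0r_neq0 rV.
rewrite !flux_energy_form // !energy_formE //.
have := Cfast_bound i U (vel U - v) (mag U - b) aU.
have := Cfast_bound i V (vel V - v) (mag V - b) aV.
have [] := alpha_ge i U V.
set s := Num.sqrt (rho U) + Num.sqrt (rho V).
set D := enorm (mag U - mag V) / s; set W := _ / s.
set wU := vel U - v; set wV := vel V - v.
set bU := mag U - b; set bV := mag V - b.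
set XU := wU 0 i * pressure pres U + wU 0 i * dot (mag U) bU
          - mag U 0 i * dot wU bU.
set XV := wV 0 i * pressure pres V + wV 0 i * dot (mag V) bV
          - mag V 0 i * dot wV bV.
set A := alpha _ _ _ _; set CU := Cfast _ _ U; set CV := Cfast _ _ V.
move=> A1 A2 A3 A4 D_ge0 /ler_normlP[XV_ge _] /ler_normlP[_ XU_le].
have sU := sqrtr_gt0 (rho U); rewrite rU in sU.
have sV := sqrtr_gt0 (rho V); rewrite rV in sV.
have s_gt0 : 0 < s by rewrite addr_gt0.
have sU2 : Num.sqrt (rho U) ^+ 2 = rho U by rewrite sqr_sqrtr ?ltW.
have sV2 : Num.sqrt (rho V) ^+ 2 = rho V by rewrite sqr_sqrtr ?ltW.
set kU := 2^-1 * (rho U * dot wU wU) in XU_le *.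
set kV := 2^-1 * (rho V * dot wV wV) in XV_ge *.
set qU := 2^-1 * dot bU bU in XU_le *; set qV := 2^-1 * dot bV bV in XV_ge *.
set g := Num.sqrt (rho U) * wU 0 i + Num.sqrt (rho V) * wV 0 i.
have vE : v 0 i = W - g / s.
  have subE (u : 'rV[R]_3) : (u - v) 0 i = u 0 i - v 0 i by rewrite !mxE.
  by rewrite /W /g /wU /wV !subE /s; field; exact: lt0r_neq0.
have dB : mag U - mag V = bU - bV by rewrite /bU /bV opprB addrA subrK.
clearbody wU wV bU bV.
have qB : qU - qV = 2^-1 * dot (mag U - mag V) (bU + bV).
  by rewrite dB !dotE (dotC bV bU) /qU /qV; ring.
have g2 : g ^+ 2 <= 4 * (kU + kV).
  have hU := ler_wpM2l (ltW rU) (sqr_entry_le_dot wU i).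
  have hV := ler_wpM2l (ltW rV) (sqr_entry_le_dot wV i).
  have := sqr_ge0 (Num.sqrt (rho U) * wU 0 i - Num.sqrt (rho V) * wV 0 i).
  have : (Num.sqrt (rho U) * wU 0 i) ^+ 2 = rho U * wU 0 i ^+ 2.
    by rewrite exprMn sU2.
  have : (Num.sqrt (rho V) * wV 0 i) ^+ 2 = rho V * wV 0 i ^+ 2.
    by rewrite exprMn sV2.
  rewrite /g /kU /kV; lra.
have c2 : dot (bU + bV) (bU + bV) <= 4 * (qU + qV).
  have := dot_ge0 (bU - bV).
  by rewrite !dotE (dotC bV bU) /qU /qV; lra.
have hD : - (g / s) * (qU - qV) <= D * (kU + kV + qU + qV).
  rewrite qB.
  have := young_dot (mag U - mag V) (bU + bV) (- g).
  rewrite sqrrN => yg; rewrite -(ler_pM2l s_gt0).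
  have -> : s * (- (g / s) * (2^-1 * dot (mag U - mag V) (bU + bV))) =
     2^-1 * (- g * dot (mag U - mag V) (bU + bV)) by field; rewrite gt_eqF.
  have -> : s * (D * (kU + kV + qU + qV)) =
     enorm (mag U - mag V) * (kU + kV + qU + qV).
    by rewrite /D; field; rewrite gt_eqF.
  have : enorm (mag U - mag V) * (g ^+ 2 + dot (bU + bV) (bU + bV)) <=
         enorm (mag U - mag V) * (4 * (kU + kV + qU + qV)).
    by apply: ler_wpM2l; rewrite ?enorm_ge0 //; lra.
  by lra.
have kU_ge0 : 0 <= kU by rewrite !mulr_ge0 ?dot_ge0 ?invr_ge0 ?ler0n ?ltW.
have kV_ge0 : 0 <= kV by rewrite !mulr_ge0 ?dot_ge0 ?invr_ge0 ?ler0n ?ltW.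
have qU_ge0 : 0 <= qU by rewrite mulr_ge0 ?dot_ge0 ?invr_ge0 ?ler0n.
have qV_ge0 : 0 <= qV by rewrite mulr_ge0 ?dot_ge0 ?invr_ge0 ?ler0n.
have h1 : (vel U 0 i + CU + D) * (rho_e U + kU) <= A * (rho_e U + kU).
  apply: ler_wpM2r; first by rewrite addr_ge0 // ltW.
  by have := ler_norm (vel U 0 i); lra.
have h2 : (- vel V 0 i + CV + D) * (rho_e V + kV) <= A * (rho_e V + kV).
  apply: ler_wpM2r; first by rewrite addr_ge0 // ltW.
  by have := ler_norm (- vel V 0 i); rewrite normrN; lra.
have h3 : (W + CU + D) * qU <= A * qU.
  by apply: ler_wpM2r => //; have := ler_norm W; lra.
have h4 : (- W + CV + D) * qV <= A * qV.
  by apply: ler_wpM2r => //; have := ler_norm (- W); rewrite normrN; lra.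
have h5 : 0 <= D * rho_e U by rewrite mulr_ge0 // ltW.
have h6 : 0 <= D * rho_e V by rewrite mulr_ge0 // ltW.
rewrite -/XU -/XV.
have -> : v 0 i * qU = W * qU - (g / s) * qU by rewrite vE; ring.
have -> : v 0 i * qV = W * qV - (g / s) * qV by rewrite vE; ring.
lra.
Qed.
End States.

(** * Affine functionals that determine admissibility *)

Section Positivity.
Context {R : rcfType}.
Implicit Types (U V : state R) (v b : 'rV[R]_3) (l : {scalar state R}).

(** The energy condition is tested at v = vel U and b = mag U, where
    [energy_formE] reduces to the internal energy. *)
Lemma admissibleP U : admissible U <->
  0 < rho U /\ forall v b, 0 < energy_form v b U + 2^-1 * dot b b.
Proof.
split=> [[r e]|[r H]]; split=> //.
  move=> v b; rewrite energy_formE ?lt0r_neq0 //.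
  rewrite -addrA ltr_wpDr // addr_ge0 //.
    by rewrite !mulr_ge0 ?dot_ge0 ?invr_ge0 ?ler0n ?ltW.
  by rewrite mulr_ge0 ?dot_ge0 ?invr_ge0 ?ler0n.
have := H (vel U) (mag U); rewrite energy_formE ?lt0r_neq0 // !subrr.
by rewrite -(scale0r (0 : 'rV_3)) !dotZl !mul0r !mulr0 !addr0.
Qed.

Lemma avg_admissible U V : admissible U -> admissible V -> admissible (avg U V).
Proof.
move=> /admissibleP[rU eU] /admissibleP[rV eV]; apply/admissibleP.
rewrite /avg; split=> [|v b]; rewrite linearZ /= linearD /=; first by lra.
by have := eU v b; have := eV v b; lra.
Qed.

Variable pres : R -> R -> R.

(** What a balance over one cell uses of an affine function l + c.  The
    coefficient k, which is v . b for the energy and 0 for the density, measures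
    how far the flux estimate fails; the source term repairs it at interfaces,
    and the divergence constraint does so inside cells. *)
Record positivity_functional l (c k : R) : Prop := PositivityFunctional {
  functional_gt0 : forall U, admissible U -> 0 < l U + c;
  functional_flux : forall i U V, admissible U -> admissible V ->
    l (flux pres i U) - l (flux pres i V) <=
    alpha pres i U V * ((l U + c) + (l V + c)) + (mag U 0 i - mag V 0 i) * k;
  functional_source : forall i be U V, admissible U -> admissible V ->
    `|jump i U V| / (2 * Num.sqrt (rho (avg U V))) <= be ->
    jump i U V * (l (source (avg U V)) + k) <= be * ((l U + c) + (l V + c))
}.

Lemma rho_positivity : positivity_functional (@rho R) 0 0.
Proof.
split=> [U [rU _]|i U V [rU _] [rV _]|i be U V [rU _] [rV _] h] /=;
  rewrite ?addr0 //.
- have scE t (u : 'rV[R]_3) : (t *: u) 0 i = t * u 0 i by rewrite mxE.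
  rewrite !mk_stateE mulr0 addr0 !momE ?lt0r_neq0 // !(scE _ (vel _)).
  have [A1 A2 _ _ D_ge0] := alpha_ge (pres := pres) i U V.
  have cU := Cfast_ge0 (pres := pres) i U.
  have cV := Cfast_ge0 (pres := pres) i V.
  have := ler_norm (vel U 0 i); have := ler_norm (- vel V 0 i); rewrite normrN.
  move=> hV hU.
  have : rho U * vel U 0 i <= rho U * alpha pres i U V.
    by apply: ler_wpM2l; [exact: ltW | lra].
  have : rho V * - vel V 0 i <= rho V * alpha pres i U V.
    by apply: ler_wpM2l; [exact: ltW | lra].
  lra.
- rewrite mk_stateE mulr0; apply: mulr_ge0; last by rewrite addr_ge0 // ltW.
  apply: le_trans h; rewrite divr_ge0 ?mulr_ge0 ?sqrtr_ge0 //.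
Qed.

(** The source estimate comes from l (S U) + v . b = w . d and
    2 sqrt rho |w . d| <= rho |w|^2 + |d|^2 at the averaged state, where
    phi is half the sum of its values at the two traces. *)
Lemma energy_positivity v b :
  positivity_functional (energy_form v b) (2^-1 * dot b b) (dot v b).
Proof.
split=> [U /admissibleP[_]|i U V|i be U V aU aV] //=.
  exact: flux_energy_pair.
set W := avg U V => h.
have aW : admissible W := avg_admissible U V aU aV.
have [rW eW] := aW.
have [_ /(_ v b) hU] := (admissibleP U).1 aU.
have [_ /(_ v b) hV] := (admissibleP V).1 aV.
have sW : 0 < Num.sqrt (rho W) by rewrite sqrtr_gt0.
have sW2 : Num.sqrt (rho W) ^+ 2 = rho W by rewrite sqr_sqrtr ?ltW.
set s := Num.sqrt (rho W) in h sW sW2.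
move: h; rewrite ler_pdivrMr ?mulr_gt0 // => h.
have be_ge0 : 0 <= be.
  rewrite -(pmulr_lge0 _ (_ : 0 < 2 * s)) ?mulr_gt0 //.
  exact: le_trans (normr_ge0 _) h.
rewrite source_energy_form.
have EW : energy_form v b U + 2^-1 * dot b b
    + (energy_form v b V + 2^-1 * dot b b) =
    2 * (energy_form v b W + 2^-1 * dot b b).
  by rewrite /W /avg linearZ /= linearD /=; field.
rewrite EW energy_formE ?lt0r_neq0 //.
move: (vel W - v) (mag W - b) => w d.
have young : 2 * s * `|dot w d| <= rho W * dot w w + dot d d.
  have hp := dot_ge0 (s *: w + d).
  have hm := dot_ge0 (s *: w - d).
  move: hp hm; rewrite !dotE (dotC d w) -sW2 => hp hm.
  by have [_|_] := ger0P (dot w d); lra.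
apply: le_trans (ler_norm _) _; rewrite normrM.
have := ler_wpM2r (normr_ge0 (dot w d)) h.
have := ler_wpM2l be_ge0 young.
have := mulr_ge0 be_ge0 (ltW eW).
lra.
Qed.

(** * Balance over one cell *)

(** Lm, Lp (resp. Rm, Rp) are the two traces at the lower (resp. upper)
    edge.  The flux estimate is used for the inner pair (Rm, Lp) and for the
    outer pair (Rp, Lm).  The viscosity a makes the outer pair contribute with a
    good sign, which leaves be times both pairs to pay for the two jumps. *)
Lemma interface_balance l c k i (a be : R) (Lm Lp Rm Rp : state R) :
  positivity_functional l c k ->
  admissible Lm -> admissible Lp -> admissible Rm -> admissible Rp ->
  alpha pres i Rm Lp + be <= a -> alpha pres i Rp Lm + be <= a ->
  `|jump i Lm Lp| / (2 * Num.sqrt (rho (avg Lm Lp))) <= be ->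
  `|jump i Rm Rp| / (2 * Num.sqrt (rho (avg Rm Rp))) <= be ->
  l (LFflux pres i a Rm Rp) - l (LFflux pres i a Lm Lp)
  + l (jump_source i Rm Rp + jump_source i Lm Lp) <=
  a * ((l Rm + c) + (l Lp + c)) + k * (mag Rm 0 i - mag Lp 0 i).
Proof.
move=> lP aLm aLp aRm aRp ha_in ha_out hL hR.
have jL := functional_source _ _ _ lP i _ _ _ aLm aLp hL.
have jR := functional_source _ _ _ lP i _ _ _ aRm aRp hR.
have f_in := functional_flux _ _ _ lP i _ _ aRm aLp.
have f_out := functional_flux _ _ _ lP i _ _ aRp aLm.
have in_ge0 : 0 <= (l Rm + c) + (l Lp + c).
  by rewrite addr_ge0 // ltW // (functional_gt0 _ _ _ lP).
have out_ge0 : 0 <= (l Rp + c) + (l Lm + c).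
  by rewrite addr_ge0 // ltW // (functional_gt0 _ _ _ lP).
have := ler_wpM2r in_ge0 ha_in; have := ler_wpM2r out_ge0 ha_out.
rewrite /LFflux /jump_source !linearE /=.
move: jL jR f_in f_out; rewrite /jump.
lra.
Qed.
End Positivity.

(** * The updated cell averages *)

Lemma le_bigmax3 {R : rcfType} {n1 n2 n3 : nat}
    (F : 'I_n1 -> 'I_n2 -> 'I_n3 -> R) i j m :
  F i j m <= \big[Num.max/0]_i \big[Num.max/0]_j \big[Num.max/0]_m F i j m.
Proof.
apply: le_trans (le_bigmax _ _ i); apply: le_trans (le_bigmax _ _ j).
exact: le_bigmax.
Qed.

Lemma bigmax3_ge0 {R : rcfType} {n1 n2 n3 : nat}
    (F : 'I_n1 -> 'I_n2 -> 'I_n3 -> R) :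
  0 <= \big[Num.max/0]_i \big[Num.max/0]_j \big[Num.max/0]_m F i j m.
Proof. exact: bigmax_ge_id. Qed.

Section Update.
Context {R : rcfType} {Nx Ny Q : nat}.
Variables (pres : R -> R -> R) (D : mesh_data R Nx Ny Q) (a1 a2 : R).
Hypotheses (hmesh : mesh_positive D) (hw : weights_normalized D)
  (hedges : edges_admissible D) (hdiv : forall i j, divB D i j = 0)
  (ha1 : alpha_hat1 D pres + beta1 D <= a1)
  (ha2 : alpha_hat2 D pres + beta2 D <= a2).

Lemma viscosity1_ge0 : 0 <= a1.
Proof. by apply: le_trans ha1; apply: addr_ge0; apply: bigmax3_ge0. Qed.

Lemma viscosity2_ge0 : 0 <= a2.
Proof. by apply: le_trans ha2; apply: addr_ge0; apply: bigmax3_ge0. Qed.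

Lemma balance_x l c k i j mu : positivity_functional pres l c k ->
  l (LFflux pres 0 a1 (UxM D (hi i) j mu) (UxP D (hi i) j mu))
  - l (LFflux pres 0 a1 (UxM D (lo i) j mu) (UxP D (lo i) j mu))
  + l (jump_source 0 (UxM D (hi i) j mu) (UxP D (hi i) j mu)
       + jump_source 0 (UxM D (lo i) j mu) (UxP D (lo i) j mu)) <=
  a1 * (l (UxP D (lo i) j mu) + l (UxM D (hi i) j mu) + 2 * c)
  + k * (mag (UxM D (hi i) j mu) 0 0 - mag (UxP D (lo i) j mu) 0 0).
Proof.
move=> lP; have [hX _] := hedges.
have [adL adL'] := hX (lo i) j mu; have [adR adR'] := hX (hi i) j mu.
apply: le_trans (interface_balance pres l c k 0 a1 (beta1 D) _ _ _ _
  lP adL adL' adR adR' _ _ _ _) _; last by lra.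
- apply: le_trans ha1; rewrite lerD2r.
  by apply: le_trans (le_bigmax3 _ i j mu); rewrite le_max lexx.
- apply: le_trans ha1; rewrite lerD2r.
  by apply: le_trans (le_bigmax3 _ i j mu); rewrite le_max lexx orbT.
- exact: (le_bigmax3 _ (lo i) j mu).
- exact: (le_bigmax3 _ (hi i) j mu).
Qed.

Lemma balance_y l c k i j mu : positivity_functional pres l c k ->
  l (LFflux pres 1 a2 (UyM D i (hi j) mu) (UyP D i (hi j) mu))
  - l (LFflux pres 1 a2 (UyM D i (lo j) mu) (UyP D i (lo j) mu))
  + l (jump_source 1 (UyM D i (hi j) mu) (UyP D i (hi j) mu)
       + jump_source 1 (UyM D i (lo j) mu) (UyP D i (lo j) mu)) <=
  a2 * (l (UyP D i (lo j) mu) + l (UyM D i (hi j) mu) + 2 * c)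
  + k * (mag (UyM D i (hi j) mu) 0 1 - mag (UyP D i (lo j) mu) 0 1).
Proof.
move=> lP; have [_ hY] := hedges.
have [adL adL'] := hY i (lo j) mu; have [adR adR'] := hY i (hi j) mu.
apply: le_trans (interface_balance pres l c k 1 a2 (beta2 D) _ _ _ _
  lP adL adL' adR adR' _ _ _ _) _; last by lra.
- apply: le_trans ha2; rewrite lerD2r.
  by apply: le_trans (le_bigmax3 _ i j mu); rewrite le_max lexx.
- apply: le_trans ha2; rewrite lerD2r.
  by apply: le_trans (le_bigmax3 _ i j mu); rewrite le_max lexx orbT.
- exact: (le_bigmax3 _ i (lo j) mu).
- exact: (le_bigmax3 _ i (hi j) mu).
Qed.

Lemma weighted_balance (l : {scalar state R}) (a c k : R)
    (FR FL S UL UR : 'I_Q -> state R) (B : 'I_Q -> R) :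
  (forall mu, l (FR mu) - l (FL mu) + l (S mu) <=
     a * (l (UL mu) + l (UR mu) + 2 * c) + k * B mu) ->
  l (\sum_mu omega D mu *: FR mu) - l (\sum_mu omega D mu *: FL mu)
  + l (\sum_mu omega D mu *: S mu) <=
  a * (l (\sum_mu omega D mu *: UL mu)
       + l (\sum_mu omega D mu *: UR mu) + 2 * c)
  + k * \sum_mu omega D mu * B mu.
Proof.
move=> H; have [w_gt0 w1] := hw.
have sumE (F : 'I_Q -> state R) :
    l (\sum_mu omega D mu *: F mu) = \sum_mu omega D mu * l (F mu).
  by rewrite linear_sum; apply: eq_bigr => mu _; rewrite linearZ.
have -> : 2 * c = \sum_mu omega D mu * (2 * c) by rewrite -mulr_suml w1 mul1r.
rewrite !sumE -!big_split /= -sumrB -big_split /= !mulr_sumr -big_split /=.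
apply: ler_sum => mu _; have := ler_wpM2l (ltW (w_gt0 mu)) (H mu).
set fr := l _; set fl := l _; set s := l _; set ul := l _; set ur := l _; lra.
Qed.

(** The residual terms k (B_i - B_i') of the two directions add up to k times
    the discrete divergence of the cell. *)
Lemma scheme_functional_ge l c k i j : positivity_functional pres l c k ->
  - l (Lh D pres a1 a2 i j) <=
  a1 / dx D * (l (PixP D (lo i) j + PixM D (hi i) j) + 2 * c)
  + a2 / dy D * (l (PiyP D i (lo j) + PiyM D i (hi j)) + 2 * c).
Proof.
move=> lP; have [dx_gt0 dy_gt0] := hmesh.
pose sx := \sum_mu omega D mu *:
  (jump_source 0 (UxM D (hi i) j mu) (UxP D (hi i) j mu)
   + jump_source 0 (UxM D (lo i) j mu) (UxP D (lo i) j mu)).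
pose sy := \sum_mu omega D mu *:
  (jump_source 1 (UyM D i (hi j) mu) (UyP D i (hi j) mu)
   + jump_source 1 (UyM D i (lo j) mu) (UyP D i (lo j) mu)).
have -> : Lh D pres a1 a2 i j =
  - (dx D)^-1 *: (Fhat1 D pres a1 (hi i) j - Fhat1 D pres a1 (lo i) j)
  - (dy D)^-1 *: (Fhat2 D pres a2 i (hi j) - Fhat2 D pres a2 i (lo j))
  + (- (dx D)^-1 *: sx - (dy D)^-1 *: sy) by [].
pose bx := \sum_mu omega D mu *
  (mag (UxM D (hi i) j mu) 0 0 - mag (UxP D (lo i) j mu) 0 0).
pose by_ := \sum_mu omega D mu *
  (mag (UyM D i (hi j) mu) 0 1 - mag (UyP D i (lo j) mu) 0 1).
have divE : bx / dx D + by_ / dy D = 0.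
  rewrite -[RHS](hdiv i j) !mulr_suml -big_split /=.
  by apply: eq_bigr => mu _; ring.
have hx : l (Fhat1 D pres a1 (hi i) j) - l (Fhat1 D pres a1 (lo i) j) + l sx <=
    a1 * (l (PixP D (lo i) j) + l (PixM D (hi i) j) + 2 * c) + k * bx.
  by apply: weighted_balance => mu; exact: balance_x.
have hy : l (Fhat2 D pres a2 i (hi j)) - l (Fhat2 D pres a2 i (lo j)) + l sy <=
    a2 * (l (PiyP D i (lo j)) + l (PiyM D i (hi j)) + 2 * c) + k * by_.
  by apply: weighted_balance => mu; exact: balance_y.
clearbody sx sy bx by_.
rewrite !(linearN, linearD, linearZ) /=.
have dxV_gt0 : 0 < (dx D)^-1 by rewrite invr_gt0.
have dyV_gt0 : 0 < (dy D)^-1 by rewrite invr_gt0.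
have := congr1 ( *%R k) divE; rewrite mulr0.
have := ler_wpM2r (ltW dxV_gt0) hx; have := ler_wpM2r (ltW dyV_gt0) hy.
move: (l (Fhat1 D pres a1 (hi i) j)) (l (Fhat1 D pres a1 (lo i) j))
  (l (Fhat2 D pres a2 i (hi j))) (l (Fhat2 D pres a2 i (lo j))) (l sx) (l sy)
  (l (PixP D (lo i) j)) (l (PixM D (hi i) j))
  (l (PiyP D i (lo j))) (l (PiyM D i (hi j))) ((dx D)^-1) ((dy D)^-1).
clear; move=> *.
lra.
Qed.

(** Substituting the decomposition of the cell average given by Pi, the value
    is at least (1 - 2 om) phi(Pi) plus (om / lam - 1) times phi at the inner
    traces, where om is the endpoint quadrature weight.  For order two,
    1 - 2 om = 0 and Pi is meaningless; the inner traces of a linear function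
    average to the cell average, which gives (1 - 2 lam) phi(Ubar) instead. *)
Lemma update_functional_gt0 l c k dt i j (n : nat) :
  positivity_functional pres l c k -> (2 <= n)%N ->
  (n = 2%N -> piecewise_linear_midpoint D) -> cells_admissible D ->
  ((3 <= n)%N -> admissible (Pi_cell D n dt a1 a2 i j)) ->
  0 < dt * (a1 / dx D + a2 / dy D) < omega_hat R n ->
  0 < l (Ubar D i j + dt *: Lh D pres a1 a2 i j) + c.
Proof.
move=> lP n2 hlin hcells hPi /andP[]; have [dx_gt0 dy_gt0] := hmesh.
have A1_ge0 : 0 <= a1 / dx D by rewrite divr_ge0 ?viscosity1_ge0 // ltW.
have A2_ge0 : 0 <= a2 / dy D by rewrite divr_ge0 ?viscosity2_ge0 // ltW.
have := scheme_functional_ge l c k i j lP.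
set A1 := a1 / dx D in A1_ge0 *; set A2 := a2 / dy D in A2_ge0 *.
set X := _ + PixM _ _ _; set Y := _ + PiyM _ _ _; set L := Lh _ _ _ _ _ _.
move=> hL lam_gt0 lam_lt.
have dt_gt0 : 0 < dt.
  have [//|dt_le0] := ltP 0 dt.
  by move: lam_gt0; rewrite ltNge mulr_le0_ge0 // addr_ge0.
have {}hL := ler_wpM2l (ltW dt_gt0) hL.
have U_gt0 := functional_gt0 _ _ _ _ lP _ (hcells i j).
rewrite linearD linearZ /=.
have w1 := hw.2.
have [n3|] := leqP 3 n; last first.
  rewrite ltnS => n_le2; have nE : n = 2%N by apply/anti_leq; rewrite n2 n_le2.
  have om : omega_hat R n = 2^-1 by rewrite nE /omega_hat /=; field.
  have [da [db lin]] := hlin nE i j.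
  have avg2 (F G : 'I_Q -> state R) :
      (forall mu, F mu + G mu = 2 *: Ubar D i j) ->
      \sum_mu omega D mu *: F mu + \sum_mu omega D mu *: G mu = 2 *: Ubar D i j.
    move=> FG; rewrite -[RHS]scale1r -[X in X *: (_ *: _)]w1 scaler_suml.
    by rewrite -big_split; apply: eq_bigr => mu _; rewrite -(FG mu) scalerDr.
  have XE : X = 2 *: Ubar D i j.
    apply: avg2 => mu; have [-> -> _ _] := lin mu.
    rewrite !scale0r !addr0 scaleNr; apply/rowP => m; rewrite !mxE; ring.
  have YE : Y = 2 *: Ubar D i j.
    apply: avg2 => mu; have [_ _ -> ->] := lin mu.
    rewrite !scale0r !addr0 scaleNr; apply/rowP => m; rewrite !mxE; ring.
  rewrite om in lam_lt; rewrite XE YE linearZ /= in hL; nra.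
have P_gt0 := functional_gt0 _ _ _ _ lP _ (hPi n3).
have om_lt : 2 * omega_hat R n < 1.
  have L3 : (3 <= uphalf (n + 2))%N.
    by rewrite addn2; case: n n3 {n2 hlin hPi lam_lt P_gt0} => [|[|[|]]].
  rewrite /omega_hat; set L' := (uphalf _)%:R.
  have L'3 : 3 <= L' :> R by rewrite ler_nat.
  rewrite ltr_pdivrMr ?mul1r; nra.
have om_gt0 := lt_trans lam_gt0 lam_lt.
set om := omega_hat R n in om_lt om_gt0 lam_lt.
set lam := dt * (A1 + A2) in lam_gt0 lam_lt.
have PE : (1 - 2 * om) * l (Pi_cell D n dt a1 a2 i j) =
   l (Ubar D i j) - om / lam * (dt * (A1 * l X + A2 * l Y)).
  rewrite /Pi_cell -/om -/X -/Y !(linearZ, linearB, linearD) /=.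
  have -> : a1 * dt / dx D + a2 * dt / dy D = lam.
    by rewrite /lam /A1 /A2; ring.
  by rewrite /A1 /A2; field; rewrite !gt_eqF //; lra.
have mean_ge0 (F G : 'I_Q -> state R) :
    (forall mu, admissible (F mu) /\ admissible (G mu)) ->
    0 <= l (\sum_mu omega D mu *: F mu + \sum_mu omega D mu *: G mu) + 2 * c.
  move=> FG; rewrite -big_split /= linear_sum.
  have -> : 2 * c = \sum_mu omega D mu * (2 * c) by rewrite -mulr_suml w1 mul1r.
  rewrite -big_split /=; apply: sumr_ge0 => mu _; have [aF aG] := FG mu.
  rewrite -scalerDr linearZ /= -mulrDr mulr_ge0 ?(ltW (hw.1 _)) // linearD /=.
  have := functional_gt0 _ _ _ _ lP _ aF.
  have := functional_gt0 _ _ _ _ lP _ aG.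
  by lra.
have X_ge0 : 0 <= l X + 2 * c.
  apply: mean_ge0 => mu.
  by split; [exact: (hedges.1 _ _ _).2 | exact: (hedges.1 _ _ _).1].
have Y_ge0 : 0 <= l Y + 2 * c.
  apply: mean_ge0 => mu.
  by split; [exact: (hedges.2 _ _ _).2 | exact: (hedges.2 _ _ _).1].
have ratio : 1 < om / lam by rewrite ltr_pdivlMr // mul1r.
have flux_ge0 : 0 <= (om / lam - 1) *
    (dt * (A1 * (l X + 2 * c) + A2 * (l Y + 2 * c))).
  rewrite mulr_ge0 ?subr_ge0 ?(ltW ratio) // mulr_ge0 ?(ltW dt_gt0) //.
  by rewrite addr_ge0 // mulr_ge0.
have lamE : om / lam * (dt * (A1 + A2)) = om by rewrite -/lam divfK // gt_eqF.
have cE := congr1 ( *%R (2 * c)) lamE.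
have om1 : 0 < 1 - 2 * om by lra.
have := mulr_gt0 om1 P_gt0.
rewrite mulrDr PE; move: hL flux_ge0 cE.
move: (l (Ubar D i j)) (l L) (l X) (l Y) (om / lam).
clear; move=> *; lra.
Qed.
End Update.

Theorem theorem2p1 (R : rcfType) (eos pres : R -> R -> R)
  (heos : eos_positive eos) (hpres : eos_pressure eos pres)
  (Nx Ny Q k : nat) (D : mesh_data R Nx Ny Q) (dt a1 a2 : R)
  (hk : (2 <= k)%N)
  (hmesh : mesh_positive D)
  (hw : weights_normalized D)
  (hk2 : k = 2%N -> Q = 1%N /\ piecewise_linear_midpoint D)
  (hcells : cells_admissible D)
  (hdiv : forall i j, divB D i j = 0)
  (hedges : edges_admissible D)
  (hPi : (3 <= k)%N -> forall i j, admissible (Pi_cell D k dt a1 a2 i j))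
  (ha1 : alpha_hat1 D pres + beta1 D <= a1)
  (ha2 : alpha_hat2 D pres + beta2 D <= a2)
  (hCFL : 0 < dt * (a1 / dx D + a2 / dy D) < omega_hat R k) :
  forall i j, admissible (Ubar D i j + dt *: Lh D pres a1 a2 i j).
Proof.
move=> i j.
have update_gt0 (l : {scalar state R}) c kappa :
    positivity_functional pres l c kappa ->
    0 < l (Ubar D i j + dt *: Lh D pres a1 a2 i j) + c.
  move=> lP; apply: (update_functional_gt0 pres D a1 a2 _ _ _ _ _ _
    _ _ _ _ _ _ k) lP hk _ hcells _ hCFL => //.
  - by move=> /hk2[].
  - by move=> /hPi.
apply/admissibleP; split=> [|v b].
  by have := update_gt0 _ _ _ (rho_positivity pres); rewrite addr0.
exact: update_gt0 _ _ _ (energy_positivity pres v b).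
Qed.
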